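(* For all integers $s,n\ge 3$, we have $r(L_{K_s}, K_n^{(3)}) < (2n)^{sn}$.
   Context: A $3$-graph is a $3$-uniform hypergraph. For $3$-graphs $H_1,H_2$, $r(H_1,H_2)$ is the smallest $N$ such that every $3$-graph on $N$ vertices contains a copy of $H_1$ or its complement contains a copy of $H_2$. $K_n^{(3)}$ is the complete $3$-graph on $n$ vertices and $K_s$ the complete graph on $s$ vertices. For a graph $G$, its link hypergraph $L_G$ is the $3$-graph on $V(G)\cup\{u\}$ ($u$ a new vertex) whose edges are the triples $\{u,v,w\}$ with $\{v,w\}\in E(G)$. *)

(* Defs.v *)
From HB Require Import structures.
From mathcomp Require Import all_boot.

Set Implicit Arguments.
Unset Strict Implicit.
Unset Printing Implicit Defensive.

Definition uniform (k : nat) (V : finType) (E : {set {set V}}) : Prop :=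
  forall e : {set V}, e \in E -> #|e| = k.

(* k-uniform hypergraphs with vertex set V; k = 2 gives simple graphs. *)
Record kgraph (k : nat) (V : finType) := KGraph {
  edges : {set {set V}};
  edges_uniform : uniform k edges
}.

Notation graph := (kgraph 2).
Notation graph3 := (kgraph 3).

Lemma complete_uniform (k : nat) (V : finType) :
  uniform k [set e : {set V} | #|e| == k].
Proof. by move=> e; rewrite inE => /eqP. Qed.

Definition complete (k n : nat) : kgraph k 'I_n :=
  KGraph (@complete_uniform k 'I_n).

Lemma complement_uniform (k : nat) (V : finType) (H : kgraph k V) :
  uniform k [set e : {set V} | (#|e| == k) && (e \notin edges H)].
Proof. by move=> e; rewrite inE => /andP[/eqP]. Qed.

Definition complement (k : nat) (V : finType) (H : kgraph k V) : kgraph k V :=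
  KGraph (@complement_uniform k V H).

Definition contains_copy (k : nat) (V W : finType)
    (H : kgraph k V) (F : kgraph k W) : Prop :=
  exists f : W -> V,
    injective f /\ forall e : {set W}, e \in edges F -> f @: e \in edges H.

(* The new vertex u is None : option V. *)
Definition link_edges (V : finType) (G : graph V) : {set {set option V}} :=
  [set None |: [set Some v | v in e] | e : {set V} in edges G].

Lemma link_uniform (V : finType) (G : graph V) : uniform 3 (link_edges G).
Proof.
move=> _ /imsetP[e eG ->]; rewrite cardsU1 card_imset; last exact: Some_inj.
rewrite (edges_uniform eG).
by have /negbTE-> : None \notin [set Some v | v in e] by apply/imsetP => -[].
Qed.

Definition link (V : finType) (G : graph V) : graph3 (option V) :=
  KGraph (@link_uniform V G).

Definition ramsey_property (V1 V2 : finType) (H1 : graph3 V1) (H2 : graph3 V2)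
    (N : nat) : Prop :=
  forall (V : finType) (H : graph3 V), #|V| = N ->
    contains_copy H H1 \/ contains_copy (complement H) H2.

(* is_ramsey_number H1 H2 N says that r(H1, H2) exists and equals N. *)
Definition is_ramsey_number (V1 V2 : finType) (H1 : graph3 V1) (H2 : graph3 V2)
    (N : nat) : Prop :=
  ramsey_property H1 H2 N /\
  forall M : nat, ramsey_property H1 H2 M -> N <= M.

(* Main.v *)
Require Import Defs.
From HB Require Import structures.
From mathcomp Require Import all_boot.
From mathcomp Require Import zify.
From Stdlib Require Import Classical.

(** Suppose that no vertex link of [H] contains a clique of size [s].  Maintain
    an independent set [B], a set [A] of candidates such that no edge consists
    of two vertices of [B] and one of [A], and for each [u] in [B] a set [W u]
    such that [{u, p, q}] is an edge for all [p] in [W u] and all other [q] in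
    [W u] or [A].  Take [v] in [A] out.  Either for many [x] in [A] the triple
    [{u, v, x}] is a non-edge for all [u] in [B], and [v] joins [B]; or some [u]
    in [B] has many [x] in [A] with [{u, v, x}] an edge, and [v] joins [W u].
    In both cases [A] shrinks by a factor of at most [2 n].  Since
    [#|W u| <= s - 2], the set [B] has [n - 1] elements after at most
    [(s - 1) (n - 1)] steps, and any remaining [x] in [A] completes it to an
    independent set of size [n]. *)

Lemma card_set3_neq {V : finType} (x y z : V) :
  #|[set x; y; z]| = 3 -> [/\ x != y, x != z & y != z].
Proof.
rewrite -setUA !cardsU1 cards1 !inE.
by case: (x == y); case: (x == z); case: (y == z).
Qed.

Lemma set3_swap {V : finType} (x y z : V) : [set x; y; z] = [set x; z; y].
Proof. by rewrite setUAC. Qed.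

Lemma set3_rot {V : finType} (x y z : V) : [set x; y; z] = [set z; x; y].
Proof. by rewrite setUC setUA. Qed.

Lemma link_complete_copy {V : finType} (H : graph3 V) (s : nat) (v : V)
    (S : {set V}) : 2 <= s <= #|S| ->
  {in S &, forall p q, p != q -> [set v; p; q] \in edges H} ->
  contains_copy H (link (complete 2 s)).
Proof.
move=> /andP[s2 sS] HS.
pose g (i : 'I_s) : V := enum_val (widen_ord sS i).
have gS i : g i \in S by apply: enum_valP.
have gI : injective g.
  by move=> i j /enum_val_inj /(congr1 val) /= /val_inj.
(* Since [S] has at least two elements, some [p] in [S] differs from [q]; the edge [[set v; p; q]]
   has three distinct vertices, so [v] may serve as the image of [None]. *)
have vS q : q \in S -> v != q.
  move=> qS; have : 0 < #|S :\ q| by move: (cardsD1 q S); rewrite qS; lia.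
  case/card_gt0P=> p /setD1P[pq pS].
  by have /edges_uniform/card_set3_neq[] := HS p q pS qS pq.
exists (fun o => if o is Some i then g i else v); split.
  case=> [i|] [j|] //= => [/gI -> //|/esym E|E].
  - by have := vS _ (gS i); rewrite E eqxx.
  - by have := vS _ (gS j); rewrite -E eqxx.
move=> _ /imsetP[e + ->]; rewrite inE => /cards2P[i [j [ij ->]]].
rewrite !imsetU !imset_set1 setUA.
by apply: HS => //; rewrite (inj_eq gI).
Qed.

Lemma complement_complete_copy {V : finType} (H : graph3 V) (n : nat)
    (B : {set V}) : n <= #|B| ->
  {in B & &, forall x y z, [set x; y; z] \notin edges H} ->
  contains_copy (complement H) (complete 3 n).
Proof.
move=> nB HB.
pose g (i : 'I_n) : V := enum_val (widen_ord nB i).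
have gB i : g i \in B by apply: enum_valP.
have gI : injective g.
  by move=> i j /enum_val_inj /(congr1 val) /= /val_inj.
exists g; split=> // e; rewrite !inE card_imset // => e3; rewrite e3 /=.
have [x xe] : exists x, x \in e by apply/card_gt0P; rewrite (eqP e3).
move: e3; rewrite (cardsD1 x) xe eqSS => /cards2P[y [z [_ E]]].
by rewrite -(setD1K xe) E setUA !imsetU !imset_set1; apply: HB.
Qed.

(** Degenerate triples are never edges, so independence can be stated for all triples without
    distinctness conditions. *)
Lemma set3_repeat_notin {V : finType} (H : graph3 V) (x y : V) :
  [set x; y; y] \notin edges H.
Proof. by apply/negP => /edges_uniform/card_set3_neq[_ _]; rewrite eqxx. Qed.

(** Triples are unordered, so [v] can be moved to the middle position; if it occurs twice, the
    triple is degenerate. *)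
Lemma indep_extend {V : finType} (H : graph3 V) (A B : {set V}) (v : V) :
  {in B &, forall x y, {in v |: B :|: A, forall z, [set x; y; z] \notin edges H}} ->
  {in B & A, forall x z, [set x; v; z] \notin edges H} ->
  {in v |: B &, forall x y,
    {in v |: B :|: A, forall z, [set x; y; z] \notin edges H}}.
Proof.
move=> indep indepv.
have vC : v \in v |: B :|: A by rewrite !inE eqxx.
have one x z : x \in B -> z \in v |: B :|: A -> [set x; v; z] \notin edges H.
  move=> xB; rewrite 2!inE => /orP[/orP[/set1P ->|zB]|zA].
  - exact: set3_repeat_notin.
  - by rewrite set3_swap indep.
  - exact: indepv.
move=> x y /setU1P[->|xB] /setU1P[->|yB] z zC; last exact: indep.
- by rewrite set3_rot set3_repeat_notin.
- by rewrite (setUC [set v]) one.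
- exact: one.
Qed.

(** Here [k] bounds the number of steps left: each step raises the potential
    [#|B| + \sum_(u in B) #|W u|] by one and costs at most a factor [2 * n] in [#|A|]. *)
Lemma greedy_independent_set {V : finType} {H : graph3 V} {s n : nat} (k : nat)
    (A B : {set V}) (W : V -> {set V}) :
  2 <= s -> 2 <= n ->
  (forall (v : V) (S : {set V}),
    {in S &, forall p q, p != q -> [set v; p; q] \in edges H} -> #|S| < s) ->
  {in B &, forall x y, {in B :|: A, forall z, [set x; y; z] \notin edges H}} ->
  {in B, forall u, {in W u, forall p, {in W u :|: A, forall q,
    p != q -> [set u; p; q] \in edges H}}} ->
  [disjoint B & A] -> {in B, forall u, [disjoint W u & A]} ->
  #|B| < n ->
  (s - 1) * (n - 1) <= #|B| + \sum_(u in B) #|W u| + k ->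
  (2 * n) ^ k <= #|A| ->
  exists2 I : {set V}, n <= #|I| &
    {in I & &, forall x y z, [set x; y; z] \notin edges H}.
Proof.
move=> s2 n2 link_clique_bound.
elim/ltn_ind: k A B W => k IHk A B W indep red disB disW ltB phi leA.
have /card_gt0P[v vA] : 0 < #|A|.
  by apply: leq_trans leA; rewrite expn_gt0; lia.
have vB : v \notin B by rewrite (disjointFl disB vA).
have vW u : u \in B -> v \notin W u.
  by move=> uB; rewrite (disjointFl (disW u uB) vA).
have indepv : {in B &, forall x y, {in v |: B, forall z,
    [set x; y; z] \notin edges H}}.
  move=> x y xB yB z /setU1P zvB; apply: indep => //.
  by case: zvB => [->|zB]; rewrite inE ?vA ?zB ?orbT.
(* Once [B] has [n - 1] elements, adding [v] finishes. *)
have [geB|ltB'] := leqP (n - 1) #|B|.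
  exists (v |: B); first by rewrite cardsU1 vB; lia.
  move=> x y z xB yB zB; apply: (indep_extend H set0 B v _ _ x y xB yB).
  - by rewrite setU0.
  - by move=> ? ? _; rewrite inE.
  - by rewrite setU0.
(* [v |: W u] is still a clique in the link of [u], so it has fewer than [s] elements. *)
have Wbound u : u \in B -> #|W u| <= s - 2.
  move=> uB; suff : #|v |: W u| < s by rewrite cardsU1 vW //; lia.
  apply: (link_clique_bound u) => p q /setU1P[->|pW] /setU1P[->|qW] pq.
  - by rewrite eqxx in pq.
  - by rewrite set3_swap red // ?inE ?vA ?orbT // eq_sym.
  - by rewrite red // !inE vA orbT.
  - by rewrite red // !inE qW.
have sumW : \sum_(u in B) #|W u| <= #|B| * (s - 2).
  by rewrite -sum_nat_const; apply: leq_sum.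
(* With [k = 0] the potential would be at least [(s - 1) * (n - 1)], but [#|B| <= n - 2] and [sumW]
   bound it by [(n - 2) * (s - 1)]. *)
case: k IHk phi leA => [|k] IHk phi leA; first by nia.
pose A0 := [set x in A :\ v | [forall (u | u \in B), [set u; v; x] \notin edges H]].
pose Ar u := [set x in A :\ v | [set u; v; x] \in edges H].
have A0P x : x \in A0 -> [/\ x \in A, x != v &
    forall u, u \in B -> [set u; v; x] \notin edges H].
  by rewrite !inE => /andP[/andP[? ?] /forall_inP].
have ArP u x : x \in Ar u -> [/\ x \in A, x != v & [set u; v; x] \in edges H].
  by rewrite !inE => /andP[/andP[? ?] ?].
have [le0|lt0] := leqP ((2 * n) ^ k) #|A0|.
  (* [W] is unconstrained outside [B], so its value at the newcomer [v] is reset to the empty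
     set. *)
  pose W' u := if u == v then set0 else W u.
  have W'B u : u \in B -> W' u = W u.
    by rewrite /W'; case: eqP => // -> vB'; rewrite vB' in vB.
  have W'v : W' v = set0 by rewrite /W' eqxx.
  apply: (IHk k (ltnSn k) A0 (v |: B) W') => //.
  - apply: indep_extend => [x y xB yB z /setUP[zB|/A0P[zA _ _]]|x z xB /A0P[_ _]].
    + exact: indepv.
    + by rewrite indep // inE zA orbT.
    + exact.
  - move=> u /setU1P[->|uB] p; first by rewrite W'v inE.
    rewrite (W'B _ uB) => pW q /setUP qWA; apply: red => //.
    by case: qWA => [qW|/A0P[qA _ _]]; rewrite inE ?qW ?qA ?orbT.
  - rewrite disjoint_sym; apply/pred0P => x /=; apply/negP => /andP[/A0P[xA xv _]].
    by rewrite !inE (negPf xv) (disjointFl disB xA).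
  - move=> u /setU1P[->|uB].
      by rewrite W'v; apply/pred0P => x; rewrite !inE.
    rewrite W'B // disjoint_sym; apply/pred0P => x /=.
    by apply/negP => /andP[/A0P[xA _ _]]; rewrite (disjointFl (disW u uB) xA).
  - by rewrite cardsU1 vB; lia.
  - rewrite cardsU1 vB big_setU1 //= W'v cards0.
    by rewrite (eq_bigr (fun u => #|W u|)) => [|u uB]; [lia | rewrite W'B].
have [/existsP[u /andP[uB leu]]|/existsPn none] :=
    boolP [exists u, (u \in B) && ((2 * n) ^ k <= #|Ar u|)].
  pose W' u' := if u' == u then v |: W u else W u'.
  have W'u : W' u = v |: W u by rewrite /W' eqxx.
  have W'n u' : u' != u -> W' u' = W u' by rewrite /W' => /negPf ->.
  apply: (IHk k (ltnSn k) (Ar u) B W') => //.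
  - move=> x y xB yB z /setUP zBA; apply: indep => //.
    by case: zBA => [zB|/ArP[zA _ _]]; rewrite inE ?zB ?zA ?orbT.
  - move=> u' u'B p; have [->|u'u] := eqVneq u' u; last first.
      rewrite W'n // => pW q /setUP qWA; apply: red => //.
      by case: qWA => [qW|/ArP[qA _ _]]; rewrite inE ?qW ?qA ?orbT.
    rewrite W'u => /setU1P[->|pW] q /setUP[/setU1P[->|qW]|/ArP[qA qv Hq]] pq //.
    + by rewrite eqxx in pq.
    + by rewrite set3_swap red // ?inE ?vA ?orbT // eq_sym.
    + by rewrite red // inE vA orbT.
    + by rewrite red // inE qW.
    + by rewrite red // inE qA orbT.
  - rewrite disjoint_sym; apply/pred0P => x /=; apply/negP => /andP[/ArP[xA _ _]].
    by rewrite (disjointFl disB xA).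
  - move=> u' u'B; rewrite disjoint_sym; apply/pred0P => x /=.
    apply/negP => /andP[/ArP[xA xv _]]; have [->|u'u] := eqVneq u' u.
      by rewrite W'u !inE (negPf xv) (disjointFl (disW u uB) xA).
    by rewrite W'n // (disjointFl (disW u' u'B) xA).
  - rewrite (bigD1 u) //= W'u cardsU1 vW //.
    rewrite (eq_bigr (fun u => #|W u|)) => [|u' /andP[_ u'u]]; last by rewrite W'n.
    by move: phi; rewrite (bigD1 u) //=; lia.
(* If [A0] and all [Ar u] are smaller than [(2 * n) ^ k], then [#|A|] is at most
   [(#|B| + 1) * (2 * n) ^ k], which is below [(2 * n) ^ k.+1]. *)
have sumA : #|A| <= 1 + #|A0| + \sum_(u in B) #|Ar u|.
  have leU : #|\bigcup_(u in B) Ar u| <= \sum_(u in B) #|Ar u|.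
    elim/big_rec2: _ => [|u m S _ IH]; first by rewrite cards0.
    by apply: leq_trans (leq_card_setU _ _) _; rewrite leq_add2l.
  apply: (leq_trans _ (leq_add (leqnn _) leU)).
  suff : A :\ v \subset A0 :|: \bigcup_(u in B) Ar u.
    move/subset_leq_card => leA0.
    rewrite (cardsD1 v A) vA -addnA leq_add2l.
    by apply: leq_trans leA0 _; apply: leq_card_setU.
  apply/subsetP => x xA; rewrite inE orbC; case: bigcupP => //= nox.
  rewrite inE xA; apply/forall_inP => u uB; apply/negP => xH.
  by case: nox; exists u; rewrite // inE xA.
have sumr : \sum_(u in B) #|Ar u| <= #|B| * (2 * n) ^ k.
  rewrite -sum_nat_const; apply: leq_sum => u uB.
  by have := none u; rewrite uB /= -ltnNge => /ltnW.
have pos : 0 < (2 * n) ^ k by rewrite expn_gt0; lia.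
by rewrite expnS in leA; nia.
Qed.

Lemma ramsey_property_link_complete (s n : nat) : 2 <= s -> 2 <= n ->
  ramsey_property (link (complete 2 s)) (complete 3 n)
    ((2 * n) ^ ((s - 1) * (n - 1))).
Proof.
move=> s2 n2 V H cardV.
have [|nolink] := classic (contains_copy H (link (complete 2 s))); first by left.
right.
(* The process starts with every vertex a candidate, [B] empty and potential zero. *)
have [||||||||] // := @greedy_independent_set V H s n ((s - 1) * (n - 1))
  setT set0 (fun=> set0) s2 n2.
- move=> v S HS; rewrite ltnNge; apply/negP => sS; apply: nolink.
  by apply: (@link_complete_copy _ H s v S); rewrite ?s2.
- by move=> x y; rewrite inE.
- by move=> u; rewrite inE.
- by apply/pred0P => x; rewrite !inE.
- by move=> u; rewrite inE.
- by rewrite cards0; lia.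
- by lia.
- by rewrite cardsT cardV.
- by move=> I nI HI; apply: (complement_complete_copy _ _ _ nI).
Qed.

(** [ramsey_property] is a [Prop] with no decision procedure at hand, so the least value comes from
    strong induction and excluded middle. *)
Lemma ramsey_number_exists {V1 V2 : finType} (H1 : graph3 V1) (H2 : graph3 V2)
    (N : nat) : ramsey_property H1 H2 N ->
  exists2 r, is_ramsey_number H1 H2 r & r <= N.
Proof.
elim/ltn_ind: N => N IH HN.
have [[M [HM ltM]]|nosmaller] :=
    classic (exists M, ramsey_property H1 H2 M /\ M < N).
  by have [r Hr ler] := IH M ltM HM; exists r => //; lia.
exists N => //; split=> // M HM; rewrite leqNgt; apply/negP => ltM.
by apply: nosmaller; exists M.
Qed.

Theorem theorem1p4 (s n : nat) (hs : 3 <= s) (hn : 3 <= n) :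
  exists r : nat,
    is_ramsey_number (link (complete 2 s)) (complete 3 n) r /\
    r < (2 * n) ^ (s * n).
Proof.
have [r Hr ler] := ramsey_number_exists _ _ _
  (ramsey_property_link_complete s n (ltnW hs) (ltnW hn)).
exists r; split=> //; apply: leq_ltn_trans ler _.
(* Strictness comes from [(s - 1) * (n - 1) < s * n] and a base above 1. *)
by rewrite ltn_exp2l; nia.
Qed.
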